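(* Let $x>0$ and let $r,s,t\in\mathbb{R}$ with $r+s+t>2$, $r+t>1$ and $s+t>1$. Then for every $n\in\mathbb{N}$, \[ \Theta(r,s,t,x) = \sum_{\ell=0}^{n} \binom{n}{\ell} x^{\ell}\, \Theta(r-n+\ell,\,s-\ell,\,t+n,\,x). \]
   Context: For $x>0$ and $(r,s,t)$ with $\Re(r+t)>1$, $\Re(s+t)>1$, $\Re(r+s+t)>2$, $\Theta(r,s,t,x)=\sum_{n=1}^{\infty}\sum_{m=1}^{\infty}\frac{1}{n^{r}m^{s}(n+mx)^{t}}$ (absolutely convergent double series). *)

(* Defs.v *)
From Stdlib Require Import Reals.
From Coquelicot Require Import Coquelicot.
Open Scope R_scope.

Definition Theta_term (r s t x : R) (n m : nat) : R :=
  1 / (Rpower (INR n) r * Rpower (INR m) s * Rpower (INR n + INR m * x) t).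

(* [Series] sums from index 0, hence the shifts by [S]: n and m range over
   the positive integers.  The terms are positive, so where the double series
   converges (x > 0, r + t > 1, s + t > 1, r + s + t > 2) it converges
   absolutely and equals this iterated sum.  Outside that region [Series] is
   total and the value carries no meaning. *)
Definition Theta (r s t x : R) : R :=
  Series (fun i : nat => Series (fun j : nat => Theta_term r s t x (S i) (S j))).

(* Main.v *)
(** Expanding (n + m x)^N by the binomial theorem shows that the identity
    already holds term by term, so only the summability of every double series
    involved has to be checked.  Each of them is dominated by products of two
    p-series: for t >= 0 split t = a + b with a, b >= 0, r + a > 1, s + b > 1 and
    use (n + m x)^t >= n^a (m x)^b; for t < 0 use
    (n + m x)^(-t) <= (2 n)^(-t) + (2 m x)^(-t). *)
Require Import Defs.
From Stdlib Require Import Reals Lra Lia.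
From Coquelicot Require Import Coquelicot.
Open Scope R_scope.

Lemma Rpower_pos (a b : R) : 0 < Rpower a b.
Proof. apply exp_pos. Qed.

Lemma ex_series_bounded (a : nat -> R) (M : R) :
  (forall n, 0 <= a n) -> (forall n, sum_f_R0 a n <= M) -> ex_series a.
Proof.
intros Ha HM.
destruct (ex_finite_lim_seq_incr (sum_f_R0 a) M) as [l Hl].
- intro n; simpl; specialize (Ha (S n)); lra.
- exact HM.
- exists l; apply is_lim_seq_Reals in Hl; apply is_series_Reals; exact Hl.
Qed.

(* Obtained from the tangent inequalities for [exp] and [ln]; plays the role of
   the integral comparison for the p-series. *)
Lemma Rpower_telescope_bound (p y : R) : 1 < p -> 0 < y ->
  (p - 1) * Rpower (y + 1) (- p)
    <= Rpower y (- (p - 1)) - Rpower (y + 1) (- (p - 1)).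
Proof.
intros Hp Hy.
set (u := ln (y + 1) - ln y).
assert (Hu : / (y + 1) <= u).
{ pose proof (exp_ineq1_le (- u)) as H.
  replace (exp (- u)) with (y / (y + 1)) in H.
  - replace (y / (y + 1)) with (1 - / (y + 1)) in H by (field; lra); lra.
  - unfold u; replace (- (ln (y + 1) - ln y)) with (ln y + - ln (y + 1)) by ring.
    rewrite exp_plus, exp_Ropp, !exp_ln by lra; reflexivity. }
(* Taking out the positive factor [Rpower (y + 1) (- (p - 1))] leaves (p - 1) / (y + 1) <= exp ((p -
   1) u) - 1, which follows from exp v >= 1 + v and [Hu]. *)
assert (H1 : Rpower y (- (p - 1)) = Rpower (y + 1) (- (p - 1)) * exp ((p - 1) * u)).
{ unfold Rpower; rewrite <- exp_plus; f_equal; unfold u; ring. }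
assert (H2 : Rpower (y + 1) (- p) = Rpower (y + 1) (- (p - 1)) * / (y + 1)).
{ rewrite <- (Rpower_1 (y + 1)) at 3 by lra.
  rewrite <- Rpower_Ropp, <- Rpower_plus; f_equal; ring. }
rewrite H1, H2.
pose proof (Rpower_pos (y + 1) (- (p - 1))) as HP.
pose proof (exp_ineq1_le ((p - 1) * u)) as He.
assert (Hm : (p - 1) * / (y + 1) <= (p - 1) * u)
  by (apply Rmult_le_compat_l; lra).
nra.
Qed.

Lemma ex_series_Rpower (p : R) : 1 < p ->
  ex_series (fun i : nat => Rpower (INR (S i)) (- p)).
Proof.
intro Hp.
apply ex_series_bounded with (M := 1 + / (p - 1)).
- intro i; left; apply Rpower_pos.
- intro i.
  (* The telescoped remainder is kept in the bound so that the induction closes; the leading 1 is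
     the first term of the series, where the remainder vanishes. *)
  assert (Hi : sum_f_R0 (fun i : nat => Rpower (INR (S i)) (- p)) i
                 <= 1 + / (p - 1) * (1 - Rpower (INR (S i)) (- (p - 1)))).
  { induction i as [|i IH].
    - simpl; unfold Rpower; rewrite ln_1, !Rmult_0_r, exp_0; lra.
    - rewrite tech5.
      pose proof (Rpower_telescope_bound p (INR (S i)) Hp) as H.
      rewrite <- S_INR in H; specialize (H (lt_0_INR (S i) ltac:(lia))).
      apply (Rmult_le_compat_l (/ (p - 1))) in H;
        [|left; apply Rinv_0_lt_compat; lra].
      rewrite <- Rmult_assoc, Rinv_l, Rmult_1_l in H by lra.
      lra. }
  pose proof (Rpower_pos (INR (S i)) (- (p - 1))) as HP.
  assert (0 < / (p - 1)) by (apply Rinv_0_lt_compat; lra).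
  nra.
Qed.

(** Convergence of the rows is demanded separately: [Series] is total, so convergence of the series
    of row sums alone would say nothing about a divergent row. *)
Definition summable2 (f : nat -> nat -> R) : Prop :=
  (forall i, ex_series (f i)) /\ ex_series (fun i => Series (f i)).

Lemma summable2_le (f g : nat -> nat -> R) :
  (forall i j, 0 <= f i j <= g i j) -> summable2 g -> summable2 f.
Proof.
intros Hfg [Hg Hg2].
assert (Hf : forall i, ex_series (f i)).
{ intro i; apply (@ex_series_le R_AbsRing R_CompleteNormedModule) with (b := g i); [|apply Hg].
  intro j; unfold norm; simpl; unfold abs; simpl.
  rewrite Rabs_pos_eq; apply Hfg. }
split; [exact Hf|].
apply (@ex_series_le R_AbsRing R_CompleteNormedModule) with (b := fun i => Series (g i)); [|exact Hg2].
intro i; unfold norm; simpl; unfold abs; simpl.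
rewrite Rabs_pos_eq.
- apply Series_le; [apply Hfg|apply Hg].
(* Writing 0 as a series of zero terms turns nonnegativity of the row sum into a termwise
   comparison. *)
- rewrite <- (Rmult_0_l (Series (f i))), <- Series_scal_l.
  apply Series_le; [|apply Hf].
  intro j; specialize (Hfg i j); lra.
Qed.

Lemma summable2_scal (c : R) (f : nat -> nat -> R) :
  summable2 f -> summable2 (fun i j => c * f i j).
Proof.
intros [Hf Hf2]; split.
- intro i; apply (ex_series_scal_l c (f i)), Hf.
- apply (ex_series_ext (fun i => c * Series (f i))).
  + intro i; symmetry; apply Series_scal_l.
  + apply (ex_series_scal_l c (fun i => Series (f i))), Hf2.
Qed.

Lemma summable2_plus (f g : nat -> nat -> R) :
  summable2 f -> summable2 g -> summable2 (fun i j => f i j + g i j).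
Proof.
intros [Hf Hf2] [Hg Hg2]; split.
- intro i; apply (ex_series_plus (f i) (g i)); auto.
- apply (ex_series_ext (fun i => Series (f i) + Series (g i))).
  + intro i; symmetry; apply Series_plus; auto.
  + apply (ex_series_plus (fun i => Series (f i)) (fun i => Series (g i))); auto.
Qed.

Lemma summable2_mult (a b : nat -> R) :
  ex_series a -> ex_series b -> summable2 (fun i j => a i * b j).
Proof.
intros Ha Hb; split.
- intro i; apply (ex_series_scal_l (a i) b), Hb.
- apply (ex_series_ext (fun i => a i * Series b)).
  + intro i; symmetry; apply Series_scal_l.
  + apply (ex_series_scal_r (Series b) a), Ha.
Qed.

Lemma summable2_Rpower (p q : R) : 1 < p -> 1 < q ->
  summable2 (fun i j => Rpower (INR (S i)) (- p) * Rpower (INR (S j)) (- q)).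
Proof. intros; apply summable2_mult; apply ex_series_Rpower; assumption. Qed.

Lemma Series2_plus (f g : nat -> nat -> R) : summable2 f -> summable2 g ->
  Series (fun i => Series (fun j => f i j + g i j))
    = Series (fun i => Series (f i)) + Series (fun i => Series (g i)).
Proof.
intros [Hf Hf2] [Hg Hg2].
rewrite <- Series_plus by assumption.
apply Series_ext; intro i; apply Series_plus; auto.
Qed.

Lemma summable2_sum (F : nat -> nat -> nat -> R) (N : nat) :
  (forall l, (l <= N)%nat -> summable2 (F l)) ->
  summable2 (fun i j => sum_f_R0 (fun l => F l i j) N).
Proof.
induction N as [|N IH]; intro H; simpl.
- apply (H 0%nat); lia.
- apply summable2_plus; [apply IH|apply H]; auto.
Qed.

Lemma Series2_sum (F : nat -> nat -> nat -> R) (N : nat) :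
  (forall l, (l <= N)%nat -> summable2 (F l)) ->
  Series (fun i => Series (fun j => sum_f_R0 (fun l => F l i j) N))
    = sum_f_R0 (fun l => Series (fun i => Series (F l i))) N.
Proof.
induction N as [|N IH]; intro H; simpl.
- reflexivity.
- rewrite <- IH by auto.
  apply (Series2_plus (fun i j => sum_f_R0 (fun l => F l i j) N) (F (S N))).
  + apply summable2_sum; auto.
  + auto.
Qed.

Lemma Theta_term_Rpower (r s t x : R) (n m : nat) :
  Theta_term r s t x n m
    = Rpower (INR n) (- r) * Rpower (INR m) (- s) * Rpower (INR n + INR m * x) (- t).
Proof.
unfold Theta_term; rewrite !Rpower_Ropp.
pose proof (Rpower_pos (INR n) r); pose proof (Rpower_pos (INR m) s).
pose proof (Rpower_pos (INR n + INR m * x) t).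
field; repeat split; lra.
Qed.

(** With b = t - a, the conditions place a between max(0, 1 - r) and min(t, s + t - 1), strictly so
    at 1 - r and at s + t - 1. Comparing each lower end with each upper end gives exactly the four
    hypotheses, and the midpoint serves as a. *)
Lemma Theta_exponent_split (r s t : R) :
  r + s + t > 2 -> r + t > 1 -> s + t > 1 -> 0 <= t ->
  exists a b, a + b = t /\ 0 <= a /\ 0 <= b /\ 1 < r + a /\ 1 < s + b.
Proof.
intros Hrst Hrt Hst Ht.
exists ((Rmax 0 (1 - r) + Rmin t (s + t - 1)) / 2),
       (t - (Rmax 0 (1 - r) + Rmin t (s + t - 1)) / 2).
unfold Rmax, Rmin; destruct (Rle_dec 0 (1 - r)), (Rle_dec t (s + t - 1)).
all: lra.
Qed.

Lemma summable2_Theta_term (r s t x : R) :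
  0 < x -> r + s + t > 2 -> r + t > 1 -> s + t > 1 ->
  summable2 (fun i j => Theta_term r s t x (S i) (S j)).
Proof.
intros Hx Hrst Hrt Hst.
assert (Hpos : forall i, 0 < INR (S i)) by (intro i; apply lt_0_INR; lia).
destruct (Rle_lt_dec 0 t) as [Ht|Ht].
- destruct (Theta_exponent_split r s t Hrst Hrt Hst Ht)
    as (a & b & Hab & Ha & Hb & Hra & Hsb).
  apply summable2_le with (g := fun i j => Rpower x (- b) *
    (Rpower (INR (S i)) (- (r + a)) * Rpower (INR (S j)) (- (s + b)))).
  2: { apply summable2_scal, summable2_Rpower; assumption. }
  intros i j; rewrite Theta_term_Rpower.
  generalize (Hpos i) (Hpos j); generalize (INR (S i)) (INR (S j)); intros n m Hn Hm.
  pose proof (Rmult_lt_0_compat m x Hm Hx) as Hmx.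
  split.
  { left; repeat apply Rmult_lt_0_compat; apply Rpower_pos. }
  replace (- t) with (- a + - b) by lra.
  replace (- (r + a)) with (- r + - a) by ring.
  replace (- (s + b)) with (- s + - b) by ring.
  rewrite !Rpower_plus.
  apply Rle_trans with (Rpower n (- r) * Rpower m (- s) *
    (Rpower n (- a) * Rpower (m * x) (- b))).
  + apply Rmult_le_compat_l.
    { left; apply Rmult_lt_0_compat; apply Rpower_pos. }
    rewrite !Rpower_Ropp.
    apply Rmult_le_compat; try (left; apply Rinv_0_lt_compat, Rpower_pos);
      apply Rinv_le_contravar; try apply Rpower_pos; apply Rle_Rpower_l; lra.
  + rewrite <- Rpower_mult_distr by assumption; right; ring.
- apply summable2_le with (g := fun i j =>
    Rpower 2 (- t) * (Rpower (INR (S i)) (- (r + t)) * Rpower (INR (S j)) (- s))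
    + Rpower (2 * x) (- t) * (Rpower (INR (S i)) (- r) * Rpower (INR (S j)) (- (s + t)))).
  (* Since t < 0, r + t > 1 and s + t > 1 also give r > 1 and s > 1, so all four exponents exceed
     1. *)
  2: { apply summable2_plus; apply summable2_scal, summable2_Rpower; lra. }
  intros i j; rewrite Theta_term_Rpower.
  generalize (Hpos i) (Hpos j); generalize (INR (S i)) (INR (S j)); intros n m Hn Hm.
  pose proof (Rmult_lt_0_compat m x Hm Hx) as Hmx.
  split.
  { left; repeat apply Rmult_lt_0_compat; apply Rpower_pos. }
  replace (- (r + t)) with (- r + - t) by ring.
  replace (- (s + t)) with (- s + - t) by ring.
  rewrite !Rpower_plus.
  apply Rle_trans with (Rpower n (- r) * Rpower m (- s) *
    (Rpower (2 * n) (- t) + Rpower (2 * (m * x)) (- t))).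
  + apply Rmult_le_compat_l.
    { left; apply Rmult_lt_0_compat; apply Rpower_pos. }
    pose proof (Rpower_pos (2 * n) (- t)) as P1.
    pose proof (Rpower_pos (2 * (m * x)) (- t)) as P2.
    (* The sum n + m x is at most twice its larger summand, and the exponent - t is positive. *)
    destruct (Rle_dec n (m * x)) as [H|H].
    * apply Rle_trans with (Rpower (2 * (m * x)) (- t)); [apply Rle_Rpower_l|]; lra.
    * apply Rle_trans with (Rpower (2 * n) (- t)); [apply Rle_Rpower_l|]; lra.
  + rewrite <- !Rpower_mult_distr by lra; right; ring.
Qed.

Lemma Theta_term_binomial (r s t x : R) (N n m : nat) : 0 < x ->
  Theta_term r s t x (S n) (S m) =
  sum_f_R0 (fun l => Binomial.C N l * x ^ l *
    Theta_term (r - INR N + INR l) (s - INR l) (t + INR N) x (S n) (S m)) N.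
Proof.
intro Hx.
assert (Hn : 0 < INR (S n)) by (apply lt_0_INR; lia).
assert (Hm : 0 < INR (S m)) by (apply lt_0_INR; lia).
(* Each summand is a binomial term of (m x + n)^N times a factor free of l; the powers (n + m x)^N
   and (n + m x)^(-N) then cancel. *)
rewrite (sum_eq _ (fun l => Binomial.C N l * (INR (S m) * x) ^ l * INR (S n) ^ (N - l) *
  (Theta_term r s t x (S n) (S m) * Rpower (INR (S n) + INR (S m) * x) (- INR N)))).
- rewrite <- scal_sum, <- binomial, Rmult_assoc.
  pose proof (Rmult_lt_0_compat _ _ Hm Hx) as Hmx.
  rewrite (Rplus_comm (INR (S m) * x)), <- Rpower_pow, <- Rpower_plus by lra.
  rewrite Rplus_opp_l, Rpower_O by lra; ring.
- intros l Hl; rewrite !Theta_term_Rpower.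
  replace (- (r - INR N + INR l)) with (- r + INR (N - l))
    by (rewrite minus_INR by assumption; ring).
  replace (- (s - INR l)) with (- s + INR l) by ring.
  replace (- (t + INR N)) with (- t + - INR N) by ring.
  rewrite Rpow_mult_distr, !Rpower_plus, !Rpower_pow by assumption.
  ring.
Qed.

(* [Binomial.C] is qualified because Coquelicot uses [C] for the complex numbers. *)
Theorem theorem3p1 (x r s t : R) (n : nat)
  (hx : 0 < x) (hrst : r + s + t > 2) (hrt : r + t > 1) (hst : s + t > 1) :
  Theta r s t x =
  sum_f_R0 (fun l : nat =>
    Binomial.C n l * x ^ l *
      Theta (r - INR n + INR l) (s - INR l) (t + INR n) x) n.
Proof.
set (F := fun l i j => Binomial.C n l * x ^ l *
  Theta_term (r - INR n + INR l) (s - INR l) (t + INR n) x (S i) (S j)).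
transitivity (Series (fun i => Series (fun j => sum_f_R0 (fun l => F l i j) n))).
- apply Series_ext; intro i; apply Series_ext; intro j.
  apply Theta_term_binomial; assumption.
- rewrite Series2_sum.
  + apply sum_eq; intros l _; unfold F, Theta.
    rewrite <- Series_scal_l; apply Series_ext; intro i; apply Series_scal_l.
  (* The shifted exponents stay in the region of convergence: their total is still r + s + t, while
     r + t grows by l and s + t by n - l >= 0. *)
  + intros l Hl; apply summable2_scal, summable2_Theta_term; [assumption| | |];
      pose proof (pos_INR l); apply le_INR in Hl; lra.
Qed.
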